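(* Let $k$ be a field, $A=k[t]$, and let $(L,\|\cdot\|)$ be a lattice over $A$. Then $L$ admits a reduced basis, i.e. there is an $A$-basis of $L$ which is a reduced set.
   Context: Let $k$ be a field, $A=k[t]$, $K=k(t)$. The degree function on $K$ is $|a/b|=\deg a-\deg b$ for nonzero $a,b\in A$, and $|0|=-\infty$. A norm on an $A$-module (or $K$-vector space) $L$ is a map $\|\cdot\|:L\to\{-\infty\}\cup\mathbb{R}$ with (1) $\|x+y\|\le\max\{\|x\|,\|y\|\}$, (2) $\|ax\|=|a|+\|x\|$ for all scalars $a$, and (3) $\|x\|=-\infty$ if and only if $x=0$. A lattice over $A$ is a pair $(L,\|\cdot\|)$, where $L$ is a finitely generated $A$-module and $\|\cdot\|$ is a norm on $L$, such that $L_{\le r}=\{x\in L: \|x\|\le r\}$ satisfies $\dim_k L_{\le r}<\infty$ for all $r\in\mathbb{R}$. Such an $L$ is automatically a free $A$-module, and the norm extends to $E=L\otimes_A K$. A finite set $\{b_1,\dots,b_m\}\subset E\setminus\{0\}$ is reduced if $\|a_1b_1+\cdots+a_mb_m\|=\max_{1\le i\le m}\|a_ib_i\|$ for all $a_1,\dots,a_m\in K$ (equivalently, for all $a_1,\dots,a_m\in A$). *)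

(* Defs.v *)
From HB Require Import structures.
From mathcomp Require Import all_boot all_order all_algebra.
From mathcomp Require Import boolp reals constructive_ereal.
From mathcomp Require Import generic_quotient fraction ring lra.

Set Implicit Arguments.
Unset Strict Implicit.
Unset Printing Implicit Defensive.

Import Order.TTheory GRing.Theory Num.Theory.
Local Open Scope ring_scope.
Local Open Scope quotient_scope.

Local Notation "x %:F" := (@FracField.tofrac _ x).

(* The scalar extension L (x)_A Frac A, realised as the localisation of the
   A-module L at A \ {0}: classes of formal fractions x/a, where x/a = y/b iff
   c b x = c a y for some c != 0. See fracmod_univ for the universal property
   of the base change. *)
Module FracMod.
Section FracMod.
Variables (A : idomainType) (L : lmodType A).

Definition preFrac := {p : L * A | p.2 != 0}.
HB.instance Definition _ := Choice.on preFrac.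

Definition equivm (p q : preFrac) : bool :=
  `[< exists2 c : A, c != 0 &
        c *: ((val q).2 *: (val p).1) = c *: ((val p).2 *: (val q).1) >].

Lemma equivm_refl : reflexive equivm.
Proof. by move=> p; apply/asboolP; exists 1; rewrite ?oner_neq0. Qed.

Lemma equivm_sym : symmetric equivm.
Proof.
by move=> p q; apply/asboolP/asboolP => -[c c0 e]; exists c; rewrite ?e.
Qed.

Lemma equivm_trans : transitive equivm.
Proof.
move=> [[y b] /= b0] [[x a] /= a0] [[z d] /= d0].
move=> /asboolP [c c0 /= e1] /asboolP [c' c'0 /= e2]; apply/asboolP => /=.
exists (c * c' * b); first by rewrite !mulf_neq0.
move: e1 e2; rewrite !scalerA => e1 e2.
have -> : c * c' * b * d = (c' * d) * (c * b) by ring.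
have -> : c * c' * b * a = (c * a) * (c' * b) by ring.
rewrite -(scalerA (c' * d)) -(scalerA (c * a)) e1 -e2 !scalerA.
by congr (_ *: _); ring.
Qed.

Canonical equivm_equiv := EquivRel equivm equivm_refl equivm_sym equivm_trans.

Definition type := {eq_quot equivm}.
HB.instance Definition _ : EqQuotient _ equivm type := EqQuotient.on type.
HB.instance Definition _ := Choice.on type.

Lemma pre0 : ((0, 1) : L * A).2 != 0. Proof. exact: oner_neq0. Qed.

(* the fraction x/a, and 0 if a = 0 *)
Definition mk (x : L) (a : A) : type :=
  \pi_type (insubd (exist (fun p : L * A => p.2 != 0) (0, 1) pre0 : preFrac) (x, a)).
Definition num (e : type) : L := (val (repr e)).1.
Definition den (e : type) : A := (val (repr e)).2.

Lemma den_neq0 e : den e != 0. Proof. exact: (valP (repr e)). Qed.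

Lemma mk_numden e : mk (num e) (den e) = e.
Proof.
rewrite /mk -[RHS]reprK; congr (\pi_type _); apply: val_inj.
by rewrite val_insubd /= den_neq0 /num /den -surjective_pairing.
Qed.

Lemma eq_mk x a y b : a != 0 -> b != 0 ->
  mk x a = mk y b <-> exists2 c, c != 0 & c *: (b *: x) = c *: (a *: y).
Proof.
move=> a0 b0; rewrite /mk; split.
  by move=> /eqmodP /asboolP; rewrite !val_insubd /= a0 b0.
by move=> h; apply/eqmodP/asboolP; rewrite !val_insubd /= a0 b0.
Qed.

Lemma mkP e : exists x a, a != 0 /\ e = mk x a.
Proof. by exists (num e), (den e); rewrite den_neq0 mk_numden. Qed.

Lemma mk_eq x a y b : a != 0 -> b != 0 -> b *: x = a *: y -> mk x a = mk y b.
Proof. by move=> a0 b0 h; apply/eq_mk => //; exists 1; rewrite ?oner_neq0 ?h. Qed.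

Lemma numdenP x a : a != 0 ->
  exists2 c, c != 0 & c *: (a *: num (mk x a)) = c *: (den (mk x a) *: x).
Proof. by move=> a0; apply/eq_mk; rewrite ?den_neq0 ?mk_numden. Qed.

Definition add e f :=
  mk (den f *: num e + den e *: num f) (den e * den f).
Definition opp e := mk (- num e) (den e).

Lemma addE x a y b : a != 0 -> b != 0 ->
  add (mk x a) (mk y b) = mk (b *: x + a *: y) (a * b).
Proof.
move=> a0 b0; rewrite /add.
have [c c0 ec] := numdenP x a0; have [d d0 ed] := numdenP y b0.
move: (num (mk x a)) (den (mk x a)) (den_neq0 (mk x a)) ec => x' a' a'0 ec.
move: (num (mk y b)) (den (mk y b)) (den_neq0 (mk y b)) ed => y' b' b'0 ed.
apply/eq_mk; rewrite ?mulf_neq0 //; exists (c * d); rewrite ?mulf_neq0 //.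
rewrite !scalerDr !scalerA; move: ec ed; rewrite !scalerA => ec ed.
have -> : c * d * (a * b) * b' = (d * b * b') * (c * a) by ring.
have -> : c * d * (a * b) * a' = (c * a * a') * (d * b) by ring.
rewrite -!(scalerA _ (_ * _)) ec ed !scalerA.
by congr (_ *: _ + _ *: _); ring.
Qed.

Lemma oppE x a : a != 0 -> opp (mk x a) = mk (- x) a.
Proof.
move=> a0; rewrite /opp; have [c c0 ec] := numdenP x a0.
apply/eq_mk; rewrite ?den_neq0 //; exists c => //.
by rewrite !scalerN ec.
Qed.

Lemma addA : associative add.
Proof.
move=> e f g; have [x [a [a0 ->]]] := mkP e; have [y [b [b0 ->]]] := mkP f.
have [z [c [c0 ->]]] := mkP g.
rewrite !addE ?mulf_neq0 //; apply: mk_eq; rewrite ?mulf_neq0 //.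
rewrite !scalerDr !scalerA -addrA.
by congr (_ *: _ + (_ *: _ + _ *: _)); ring.
Qed.

Lemma addC : commutative add.
Proof. by move=> e f; rewrite /add addrC mulrC. Qed.

Lemma add0e : left_id (mk 0 1) add.
Proof.
move=> e; have [x [a [a0 ->]]] := mkP e.
by rewrite addE ?oner_neq0 // scaler0 add0r scale1r mul1r.
Qed.

Lemma addNe : left_inverse (mk 0 1) opp add.
Proof.
move=> e; have [x [a [a0 ->]]] := mkP e; rewrite oppE // addE //.
apply: mk_eq; rewrite ?mulf_neq0 ?oner_neq0 //.
by rewrite scalerN addNr !scaler0.
Qed.

HB.instance Definition _ := GRing.isZmodule.Build type addA addC add0e addNe.

Definition scale (f : {fraction A}) (e : type) :=
  mk (\n_(repr f) *: num e) (\d_(repr f) * den e).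

Lemma fracE (f : {fraction A}) : f = (\n_(repr f))%:F / (\d_(repr f))%:F.
Proof.
have d0 : \d_(repr f) != 0 by exact: denom_ratioP.
apply: (mulIf (x := (\d_(repr f))%:F)); first by rewrite tofrac_eq0.
rewrite divfK ?tofrac_eq0 //; rewrite -[X in X * _]reprK.
move: (repr f) d0 => {f} p d0; unlock FracField.tofrac.
rewrite -[LHS]FracField.pi_mul.
apply/eqmodP; rewrite /= FracField.equivfE /FracField.mulf
  !numden_Ratio ?mulf_neq0 ?oner_neq0 // ?mulr1.
by rewrite mulrC.
Qed.

Lemma fracP (f : {fraction A}) : exists n d, d != 0 /\ f = n%:F / d%:F.
Proof.
exists (\n_(repr f)), (\d_(repr f)); split; last exact: fracE.
exact: denom_ratioP.
Qed.

Lemma frac_numden n d : d != 0 ->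
  let f := n%:F / d%:F : {fraction A} in d * \n_(repr f) = \d_(repr f) * n.
Proof.
move=> d0 f; have := fracE f.
have r0 : \d_(repr f) != 0 by exact: denom_ratioP.
rewrite {1}/f => /eqP; rewrite eqr_div ?tofrac_eq0 // -!tofracM tofrac_eq.
by move=> /eqP e; rewrite mulrC -e mulrC.
Qed.

Lemma scaleE n d x a : d != 0 -> a != 0 ->
  scale (n%:F / d%:F) (mk x a) = mk (n *: x) (d * a).
Proof.
move=> d0 a0; rewrite /scale; have := frac_numden n d0 => /=.
have : \d_(repr (n%:F / d%:F : {fraction A})) != 0 by exact: denom_ratioP.
move: (\n_(repr _)) (\d_(repr _)) => n' d' d'0 ef.
have [c c0 ec] := numdenP x a0.
move: (num (mk x a)) (den (mk x a)) (den_neq0 (mk x a)) ec => x' a' a'0 ec.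
apply/eq_mk; rewrite ?mulf_neq0 //; exists c; rewrite ?mulf_neq0 //.
move: ec; rewrite !scalerA => ec.
have -> : c * (d * a) * n' = (d * n') * (c * a) by ring.
have -> : c * (d' * a') * n = (d' * n) * (c * a') by ring.
by rewrite -!(scalerA (_ * _) (_ * _)) ec ef.
Qed.

Lemma scaleA f g e : scale f (scale g e) = scale (f * g) e.
Proof.
have [n [d [d0 ->]]] := fracP f; have [n' [d' [d'0 ->]]] := fracP g.
have [x [a [a0 ->]]] := mkP e.
rewrite mulf_div -!tofracM !scaleE ?mulf_neq0 //.
by rewrite scalerA mulrA.
Qed.

Lemma scale1 : left_id 1 scale.
Proof.
move=> e; have [x [a [a0 ->]]] := mkP e.
have -> : 1 = 1%:F / 1%:F :> {fraction A} by rewrite tofrac1 divr1.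
by rewrite scaleE ?oner_neq0 // scale1r mul1r.
Qed.

Lemma scaleDr : right_distributive scale +%R.
Proof.
move=> f e g; have [n [d [d0 ->]]] := fracP f.
have [x [a [a0 ->]]] := mkP e; have [y [b [b0 ->]]] := mkP g.
rewrite /GRing.add /= addE // !scaleE ?mulf_neq0 // addE ?mulf_neq0 //.
apply: mk_eq; rewrite ?mulf_neq0 // !scalerDr !scalerA.
by congr (_ *: _ + _ *: _); ring.
Qed.

Lemma scaleDl e : {morph scale^~ e : f g / f + g}.
Proof.
move=> f g; have [n [d [d0 ->]]] := fracP f; have [n' [d' [d'0 ->]]] := fracP g.
have [x [a [a0 ->]]] := mkP e.
rewrite addf_div ?tofrac_eq0 // -!tofracM -tofracD [RHS]/GRing.add /=.
rewrite !scaleE ?mulf_neq0 // addE ?mulf_neq0 //.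
apply: mk_eq; rewrite ?mulf_neq0 // !scalerDr !scalerA -scalerDl.
by congr (_ *: _); ring.
Qed.

HB.instance Definition _ :=
  GRing.Zmodule_isLmodule.Build {fraction A} type scaleA scale1 scaleDr scaleDl.

Lemma mkD x a y b : a != 0 -> b != 0 ->
  mk x a + mk y b = mk (b *: x + a *: y) (a * b).
Proof. exact: addE. Qed.

Lemma mkZ n d x a : d != 0 -> a != 0 ->
  (n%:F / d%:F) *: mk x a = mk (n *: x) (d * a).
Proof. exact: scaleE. Qed.

End FracMod.
End FracMod.
HB.export FracMod.

Notation fracmod := FracMod.type.

Definition tofracmod (A : idomainType) (L : lmodType A) (x : L) : fracmod L :=
  FracMod.mk x 1.

Section FracModTheory.
Variables (A : idomainType) (L : lmodType A).
Implicit Types (x y : L) (a : A) (e : fracmod L).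

Lemma tofracmodD : {morph @tofracmod A L : x y / x + y}.
Proof.
move=> x y; rewrite /tofracmod FracMod.mkD ?oner_neq0 //.
by rewrite !scale1r mulr1.
Qed.

Lemma tofracmodZ a x : tofracmod (a *: x) = a%:F *: tofracmod x.
Proof.
have -> : a%:F = a%:F / 1%:F :> {fraction A} by rewrite tofrac1 divr1.
by rewrite /tofracmod FracMod.mkZ ?oner_neq0 // mulr1.
Qed.

Lemma mk_tofracmod x a : a != 0 -> FracMod.mk x a = a%:F^-1 *: tofracmod x.
Proof.
move=> a0; have -> : a%:F^-1 = 1%:F / a%:F :> {fraction A}
  by rewrite tofrac1 div1r.
by rewrite /tofracmod FracMod.mkZ ?oner_neq0 // mulr1 scale1r.
Qed.

Lemma fracmodP e : exists x a, a != 0 /\ e = a%:F^-1 *: tofracmod x.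
Proof.
have [x [a [a0 ->]]] := FracMod.mkP e.
by exists x, a; rewrite -mk_tofracmod.
Qed.

Lemma fracmod_univ (W : lmodType {fraction A}) (f : L -> W)
    (fD : {morph f : x y / x + y}) (fZ : forall a x, f (a *: x) = a%:F *: f x) :
  exists2 g : {linear fracmod L -> W}, forall x, g (tofracmod x) = f x
    & forall h : {linear fracmod L -> W},
        (forall x, h (tofracmod x) = f x) -> h =1 g.
Proof.
pose g0 e := (FracMod.den e)%:F^-1 *: f (FracMod.num e).
have g0E x a : a != 0 -> g0 (FracMod.mk x a) = a%:F^-1 *: f x.
  move=> a0; rewrite /g0; have [c c0 ec] := FracMod.numdenP x a0.
  move: (FracMod.num _) (FracMod.den _) (FracMod.den_neq0 (FracMod.mk x a)) ec
    => x' a' a'0 /(congr1 f); rewrite !fZ.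
  move=> /(can_inj (scalerK _)) -/(_ _) ; rewrite tofrac_eq0 => /(_ c0) ec.
  apply: (can_inj (scalerK (a := a%:F * a'%:F) _)).
    by rewrite mulf_neq0 ?tofrac_eq0.
  by rewrite !scalerA mulfK ?tofrac_eq0 // ec mulrAC divff ?tofrac_eq0 // mul1r.
have glin : linear g0.
  move=> s e e'; have [n [d [d0 ->]]] := FracMod.fracP s.
  have [x [a [a0 ->]]] := FracMod.mkP e.
  have [y [b [b0 ->]]] := FracMod.mkP e'.
  rewrite FracMod.mkZ // FracMod.mkD ?mulf_neq0 //.
  rewrite !g0E ?mulf_neq0 // fD !fZ scalerDr !scalerA !tofracM.
  have dF : d%:F != 0 :> {fraction A} by rewrite tofrac_eq0.
  have aF : a%:F != 0 :> {fraction A} by rewrite tofrac_eq0.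
  have bF : b%:F != 0 :> {fraction A} by rewrite tofrac_eq0.
  move: a%:F b%:F d%:F n%:F aF bF dF => u v w z u0 v0 w0.
  congr (_ *: _ + _ *: _).
    by rewrite [v * z]mulrC !invfM mulrACA mulVf // mulr1 mulrC mulrA.
  by rewrite invfM mulrAC mulVf ?mulf_neq0 // mul1r.
pose gl := GRing.isLinear.Build _ _ _ _ g0 glin.
pose g : {linear fracmod L -> W} := HB.pack g0 gl.
exists g => [x|h hE e].
  by rewrite /g /= /tofracmod g0E ?oner_neq0 // tofrac1 invr1 scale1r.
have [x [a [a0 ->]]] := FracMod.mkP e.
by rewrite /g /= g0E // mk_tofracmod // linearZ /= hE.
Qed.

End FracModTheory.

Section Norms.
Variables (R : realType) (k : fieldType).
Local Notation A := {poly k}.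
Local Notation K := {fraction {poly k}}.
Local Open Scope ereal_scope.

(* MathComp's size is the degree plus one. *)
Definition deg (p : A) : \bar R :=
  if p == 0%R then -oo else ((size p).-1%:R)%:E.

(* |a/b| = deg a - deg b; independent of the representative by fdeg_frac *)
Definition fdeg (f : K) : \bar R := deg \n_(repr f) - deg \d_(repr f).

(* The values +oo of \bar R are excluded, leaving {-oo} u R. *)
Definition is_norm (S : nzRingType) (absS : S -> \bar R) (V : lmodType S)
    (norm : V -> \bar R) : Prop :=
  [/\ forall x, norm x != +oo,
      forall x y, norm (x + y)%R <= maxe (norm x) (norm y),
      forall a x, norm (a *: x)%R = absS a + norm x
    & forall x, norm x = -oo <-> x = 0%R].

Definition finitely_generated (S : nzRingType) (V : lmodType S) : Prop :=
  exists (n : nat) (g : 'I_n -> V), forall x : V,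
    exists c : 'I_n -> S, (x = \sum_(i < n) c i *: g i)%R.

(* P is the k-span of finitely many vectors, k acting through
   the constant polynomials. *)
Definition fin_dim (L : lmodType A) (P : L -> Prop) : Prop :=
  exists (n : nat) (v : 'I_n -> L), forall x : L,
    P x <-> exists c : 'I_n -> k, (x = \sum_(i < n) (c i)%:P *: v i)%R.

Definition is_lattice (L : lmodType A) (norm : L -> \bar R) : Prop :=
  [/\ finitely_generated L, is_norm deg norm
    & forall r : R, fin_dim (fun x => norm x <= r%:E)].

Definition is_basis (S : nzRingType) (V : lmodType S) (m : nat)
    (b : 'I_m -> V) : Prop :=
  (forall x : V, exists c : 'I_m -> S, (x = \sum_(i < m) c i *: b i)%R) /\
  (forall c : 'I_m -> S,
     (\sum_(i < m) c i *: b i = 0)%R -> forall i, c i = 0%R).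

(* ||x/a|| = ||x|| - |a|; see ext_norm_mk, ext_norm_is_norm and
   ext_norm_tofracmod. *)
Definition ext_norm (L : lmodType A) (norm : L -> \bar R) (e : fracmod L) :
    \bar R :=
  norm (FracMod.num e) - deg (FracMod.den e).

Definition reduced (V : lmodType K) (norm : V -> \bar R) (m : nat)
    (b : 'I_m -> V) : Prop :=
  (forall i, b i != 0%R) /\
  forall a : 'I_m -> K,
    norm (\sum_(i < m) a i *: b i)%R =
      \big[maxe/-oo]_(i < m) norm (a i *: b i)%R.

Lemma deg0 : deg 0%R = -oo. Proof. by rewrite /deg eqxx. Qed.

Lemma degE (p : A) : p != 0%R -> deg p = ((size p).-1%:R)%:E.
Proof. by rewrite /deg => /negbTE ->. Qed.

Lemma deg_fin (p : A) : p != 0%R -> deg p \is a fin_num.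
Proof. by move=> p0; rewrite degE. Qed.

Lemma deg_npinfty (p : A) : deg p != +oo.
Proof. by rewrite /deg; case: ifP. Qed.

Lemma degM (p q : A) : deg (p * q)%R = deg p + deg q.
Proof.
have [->|p0] := eqVneq p 0%R.
  by rewrite mul0r deg0 addeC addeNy.
have [->|q0] := eqVneq q 0%R.
  by rewrite mulr0 deg0 addeNy.
rewrite !degE ?mulf_neq0 // -EFinD -natrD size_mul //; congr (_%:R%:E)%R.
move: (size_poly_gt0 p) (size_poly_gt0 q); rewrite p0 q0.
by case: (size p) => // n; case: (size q) => // m _ _; rewrite addSn /= addnS.
Qed.

Lemma fdeg_frac (a b : A) : b != 0%R ->
  fdeg (a%:F / b%:F)%R = deg a - deg b.
Proof.
move=> b0; rewrite /fdeg; have := FracMod.frac_numden a b0 => /=.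
have : \d_(repr (a%:F / b%:F : K)%R) != 0%R by exact: denom_ratioP.
move: (\n_(repr _)) (\d_(repr _)) => n d d0 /(congr1 deg); rewrite !degM.
rewrite (degE b0) (degE d0); have := deg_npinfty n; have := deg_npinfty a.
case: (deg n) (deg a) => [u||] [v||] //= _ _ [].
by move=> e; congr (_%:E); lra.
Qed.

Section Extension.
Variables (L : lmodType A) (norm : L -> \bar R).
Hypothesis normP : is_norm deg norm.

Lemma ext_norm_mk (x : L) (a : A) : a != 0%R ->
  ext_norm norm (FracMod.mk x a) = norm x - deg a.
Proof.
case: normP => npinf _ nZ _ a0; rewrite /ext_norm.
have [c c0] := FracMod.numdenP x a0.
move: (FracMod.num _) (FracMod.den _) (FracMod.den_neq0 (FracMod.mk x a)).
move=> x' a' a'0 /(congr1 norm); rewrite !nZ.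
rewrite (degE a0) (degE a'0) (degE c0).
have := npinf x; have := npinf x'.
case: (norm x) (norm x') => [u||] [v||] //= _ _ [].
by move=> /addrI e; congr (_%:E); lra.
Qed.

Lemma ext_norm_tofracmod (x : L) : ext_norm norm (tofracmod x) = norm x.
Proof. by rewrite ext_norm_mk ?oner_neq0 // degE ?oner_neq0 // size_poly1 sube0. Qed.

Lemma ext_norm_is_norm : is_norm fdeg (ext_norm norm).
Proof.
case: normP => npinf nD nZ n0; split.
- move=> e; rewrite /ext_norm (degE (FracMod.den_neq0 e)).
  by have := npinf (FracMod.num e); case: (norm _).
- move=> e f; have [x [a [a0 ->]]] := FracMod.mkP e.
  have [y [b [b0 ->]]] := FracMod.mkP f.
  rewrite FracMod.mkD // !ext_norm_mk ?mulf_neq0 // leeBlDr; last first.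
    by rewrite deg_fin ?mulf_neq0.
  apply: (le_trans (nD _ _)); rewrite !nZ degM (degE a0) (degE b0).
  have := npinf x; have := npinf y.
  case: (norm x) (norm y) => [u||] [v||] //= _ _.
  + rewrite -!EFinB -!EFinD -!EFin_max -EFinD lee_fin addr_maxl.
    by rewrite le_max !ge_max; apply/orP; lra.
  + by rewrite ?addeNy ?addNye ?maxeNy -!EFinD lee_fin; lra.
  + by rewrite ?addeNy ?addNye ?maxNye -!EFinD lee_fin; lra.
- move=> s e; have [n [d [d0 ->]]] := FracMod.fracP s.
  have [x [a [a0 ->]]] := FracMod.mkP e.
  rewrite FracMod.mkZ // fdeg_frac // !ext_norm_mk ?mulf_neq0 // nZ degM.
  rewrite (degE a0) (degE d0).
  have := npinf x; have := deg_npinfty n.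
  case: (norm x) (deg n) => [u||] [v||] //= _ _.
  by congr (_%:E); ring.
- move=> e; have [x [a [a0 ->]]] := FracMod.mkP e.
  rewrite ext_norm_mk // (degE a0) mk_tofracmod //; split.
    have := npinf x; case E : (norm x) => [u||] //= _ _.
    by move/n0: E => ->; rewrite -mk_tofracmod //; apply: FracMod.mk_eq;
      rewrite ?oner_neq0 // !scaler0.
  rewrite -mk_tofracmod // => /FracMod.eq_mk -/(_ a0 (oner_neq0 _)) [c c0].
  rewrite scale1r !scaler0 => /(congr1 norm).
  have [_ ->//] := n0 0%R; rewrite nZ (degE c0); case: (norm x) => //.
Qed.

End Extension.
End Norms.

(* Main.v *)
Require Import Defs.
From mathcomp Require Import all_boot all_order all_algebra.
From mathcomp Require Import reals constructive_ereal.
From mathcomp Require Import boolp.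

(** A reduced basis is built greedily, by successive minima.  Suppose that
    b_1, ..., b_m is reduced and that its k[t]-span M is not all of L.  Choose
    y outside M of least norm ([exists_min_norm]) and adjoin it.

    The enlarged family is again reduced ([reduced_over_A_cons]): in a
    combination x = a_0 y + sum a_j b_j with a_0 nonzero, divide each a_j by
    a_0 with remainder, so that x = a_0 (y + q) + r with q in M and r a
    combination of the b_j with coefficients of degree less than deg a_0.
    As y + q is still outside M, its norm is at least that of y.  As each b_j
    was itself chosen of least norm outside a smaller submodule, its norm is
    at most that of y, and r is strictly smaller than a_0 y.  Hence
    ||a_0 y|| <= ||a_0 (y + q)|| <= ||x||, and the remaining terms are
    controlled by the reducedness of b_1, ..., b_m applied to x - a_0 y.

    The two finiteness points, that a least norm is attained and that the
    process stops, both come from the finite dimension over k of the balls of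
    L, through [fin_dim_bound].  Elements of strictly decreasing norms are
    k-independent ([decreasing_free]), so there is no infinite descent of
    norms.  And if r bounds the norms of a finite set of generators of L, some
    generator lies outside M whenever M is not L, so the process never leaves
    the ball of radius r; as reduced families are independent, it stops.
    Freeness of L is thus obtained together with the reduced basis, without
    the structure theorem for modules over k[t].

    The inequalities above concern coefficients in k[t]; clearing a common
    denominator extends them to k(t) ([reduced_tofracmod]). *)

Set Implicit Arguments.
Unset Strict Implicit.
Unset Printing Implicit Defensive.

Import Order.TTheory GRing.Theory Num.Theory.
Local Open Scope ring_scope.
Local Open Scope ereal_scope.

(** * Ultrametric norms *)

Section Norm.
Variables (R : realType) (S : nzRingType) (absS : S -> \bar R).
Variables (V : lmodType S) (norm : V -> \bar R).
Hypothesis normP : is_norm absS norm.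

Lemma norm0 : norm 0%R = -oo.
Proof. by case: normP => _ _ _ n0; apply/n0. Qed.

Lemma norm_fin_num x : x != 0%R -> norm x \is a fin_num.
Proof.
case: normP => npinf _ _ n0 /eqP x0; have := npinf x; have := n0 x.
by case: (norm x) => // -[xE _] _; case: x0; exact: xE.
Qed.

Lemma norm_sum_le (I : Type) (s : seq I) (F : I -> V) (r : \bar R) :
  (forall i, norm (F i) <= r) -> norm (\sum_(i <- s) F i)%R <= r.
Proof.
case: normP => _ nD _ _ Fr.
elim/big_ind : _ => // [|x y xr yr]; first by rewrite norm0 leNye.
by rewrite (le_trans (nD _ _))// ge_max xr.
Qed.

Lemma norm_sum_lt (I : Type) (s : seq I) (F : I -> V) (r : \bar R) :
  -oo < r -> (forall i, norm (F i) < r) -> norm (\sum_(i <- s) F i)%R < r.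
Proof.
case: normP => _ nD _ _ r0 Fr.
elim/big_ind : _ => // [|x y xr yr]; first by rewrite norm0.
by rewrite (le_lt_trans (nD _ _))// gt_max xr.
Qed.

Lemma norm_sum_bigmax (m : nat) (F : 'I_m -> V) :
  norm (\sum_(i < m) F i)%R <= \big[maxe/-oo]_(i < m) norm (F i).
Proof. by apply: norm_sum_le => i; exact: le_bigmax. Qed.

End Norm.

(** * Lattices over k[t] *)

Definition generates (S : nzRingType) (V : lmodType S) (m : nat)
    (b : 'I_m -> V) (x : V) : Prop :=
  exists c : 'I_m -> S, x = (\sum_(i < m) c i *: b i)%R.

Lemma generates_sub (S : nzRingType) (V : lmodType S) m (b : 'I_m -> V) x y :
  generates b x -> generates b y -> generates b (x - y)%R.
Proof.
move=> [c ->] [d ->]; exists (fun i => c i - d i)%R.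
by rewrite -sumrB; apply: eq_bigr => i _; rewrite scalerBl.
Qed.

Lemma generates_sum (S : nzRingType) (V : lmodType S) m (b : 'I_m -> V)
    n (g : 'I_n -> V) :
  (forall j, generates b (g j)) -> forall x, generates g x -> generates b x.
Proof.
move=> /choice [c gE] x [d ->].
exists (fun i => \sum_j d j * c j i)%R.
under eq_bigr => j _ do rewrite gE scaler_sumr.
rewrite exchange_big; apply: eq_bigr => i _.
by rewrite scaler_suml; apply: eq_bigr => j _; rewrite scalerA.
Qed.

(** The new vector goes in front, so that sums over the enlarged family split
    by [big_ord_recl]. *)
Definition fam_cons (T : Type) (m : nat) (y : T) (b : 'I_m -> T) :
  'I_m.+1 -> T := fun i => oapp b y (unlift ord0 i).

Lemma fam_cons0 T m (y : T) (b : 'I_m -> T) : fam_cons y b ord0 = y.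
Proof. by rewrite /fam_cons unlift_none. Qed.

Lemma fam_consS T m (y : T) (b : 'I_m -> T) i :
  fam_cons y b (lift ord0 i) = b i.
Proof. by rewrite /fam_cons liftK. Qed.

Section Lattice.
Variables (R : realType) (k : fieldType) (L : lmodType {poly k}).
Local Notation A := {poly k}.
Local Notation deg := (@deg R k).

Lemma deg_polyC (c : k) : c != 0%R -> deg c%:P = 0.
Proof. by move=> c0; rewrite degE ?polyC_eq0// size_polyC c0. Qed.

Lemma deg_modp (p q : A) : q != 0%R -> deg (p %% q)%R < deg q.
Proof.
move=> q0; have [->|r0] := eqVneq (p %% q)%R 0%R.
  by rewrite deg0 degE// ltNyr.
rewrite !degE// lte_fin ltr_nat.
have := ltn_modpN0 p q0; rewrite -size_poly_gt0 in r0.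
by case: (size _) r0 => // n _; case: (size q).
Qed.

Definition free_over_k (m : nat) (x : 'I_m -> L) : Prop :=
  forall c : 'I_m -> k, (\sum_(i < m) (c i)%:P *: x i = 0)%R ->
    forall i, c i = 0%R.

(** Coordinates of the x_i on a spanning family of P form an m x N matrix; a
    row of its left kernel is a k-linear relation between the x_i, so the
    matrix is row free and m <= N. *)
Lemma fin_dim_bound (P : L -> Prop) : fin_dim P ->
  exists N : nat, forall m (x : 'I_m -> L),
    (forall i, P (x i)) -> free_over_k x -> (m <= N)%N.
Proof.
move=> [N [v vP]]; exists N => m x Px free_x.
have /choice [C xE] : forall i, exists c : 'I_N -> k,
    x i = (\sum_(j < N) (c j)%:P *: v j)%R by move=> i; apply/vP.
pose M := (\matrix_(i < m, j < N) C i j)%R.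
suff /eqP <- : row_free M by exact: rank_leq_col.
rewrite -kermx_eq0; apply/eqP/row_matrixP => i; rewrite row0.
have uM : (row i (kermx M) *m M = 0)%R by rewrite -row_mul mulmx_ker row0.
move: (row i _) uM => u uM.
apply/rowP => j; rewrite [RHS]mxE; apply: (free_x (fun j => u ord0 j)).
under eq_bigr => l _ do rewrite xE scaler_sumr.
rewrite exchange_big big1// => l _.
have := congr1 (fun w : 'rV_N => (w ord0 l)%:P) uM.
rewrite !mxE rmorph0 rmorph_sum /= => uMl.
rewrite -[RHS](scale0r (v l)) -uMl scaler_suml; apply: eq_bigr => h _.
by rewrite scalerA mxE -rmorphM.
Qed.

Variable norm : L -> \bar R.
Hypothesis normP : is_norm deg norm.

Lemma normN x : norm (- x)%R = norm x.
Proof.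
case: normP => _ _ nZ _; rewrite -scaleN1r nZ -[(-1)%R]/(- (1%:P))%R -polyCN.
by rewrite deg_polyC ?oppr_eq0 ?oner_eq0// add0e.
Qed.

Lemma norm_le_max x y : norm (x - y)%R <= maxe (norm x) (norm y).
Proof. by case: normP => _ nD _ _; rewrite -[norm y]normN nD. Qed.

(** The ultrametric inequality for x = (x + y) - y, whose last term is too
    small to account for x. *)
Lemma norm_add_ge x y : norm y < norm x -> norm x <= norm (x + y)%R.
Proof.
move=> yx; have := norm_le_max (x + y)%R y.
by rewrite addrK le_max [in X in _ || X]leNgt yx orbF.
Qed.

Lemma normZk_le (c : k) x : norm (c%:P *: x)%R <= norm x.
Proof.
case: normP => _ _ nZ _; have [->|c0] := eqVneq c 0%R.
  by rewrite scale0r (norm0 normP) leNye.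
by rewrite nZ deg_polyC// add0e.
Qed.

(** In a relation, the first term with a nonzero coefficient has a norm larger
    than those of all the following terms, and so cannot cancel them. *)
Lemma decreasing_free (u : nat -> L) (m : nat) :
  (forall n, norm (u n.+1) < norm (u n)) ->
  free_over_k (fun i : 'I_m => u i).
Proof.
elim: m u => [|m IH] u u_dec c; first by move=> _ [].
have u_le n : norm (u n.+1) <= norm (u 1%N).
  by elim: n => // n /(le_trans _) -> //; exact/ltW.
case: (normP) => _ _ nZ _.
rewrite big_ord_recl => /eqP; rewrite addr_eq0 => /eqP cE.
have c0 : c ord0 = 0%R.
  apply/eqP/negPn/negP => c0.
  have := u_dec 0%N; rewrite ltNge => /negP; apply.
  have -> : norm (u 0%N) = norm ((c ord0)%:P *: u 0%N)%R.
    by rewrite nZ deg_polyC// add0e.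
  rewrite cE normN; apply: (norm_sum_le normP) => i.
  by rewrite (le_trans (normZk_le _ _))//; exact: u_le.
move: cE; rewrite c0 scale0r => /esym/eqP; rewrite oppr_eq0 => /eqP cE.
move=> i; case: (unliftP ord0 i) => [j ->|->//].
exact: (IH (fun n => u n.+1) (fun n => u_dec n.+1) (fun i => c (lift ord0 i))).
Qed.

Hypothesis finP : forall r : R, fin_dim (fun x => norm x <= r%:E).

(** Without a minimum, X contains a sequence of strictly decreasing norms; it
    stays in one ball, where its first terms would be arbitrarily many
    k-independent vectors. *)
Lemma exists_min_norm (X : L -> Prop) : (exists x, X x) ->
  exists2 y, X y & forall x, X x -> norm y <= norm x.
Proof.
move=> [x0 Xx0]; apply: contrapT => nomin.
have next (x : L) : exists y, X x -> X y /\ norm y < norm x.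
  have [Xx|nXx] := pselect (X x); last by exists x.
  apply: contrapT => nx; apply: nomin; exists x => // z Xz.
  by rewrite leNgt; apply/negP => zx; apply: nx; exists z.
have [f fP] := choice next.
pose u n := iter n f x0.
have Xu n : X (u n) by elim: n => // n /fP[].
have u_dec n : norm (u n.+1) < norm (u n) by have [] := fP _ (Xu n).
have u_le n : norm (u n) <= (fine (norm x0))%:E.
  elim: n => [|n /(le_trans _) -> //]; last exact/ltW.
  case: normP => npinf _ _ _; rewrite /u /=.
  by have := npinf x0; case: (norm x0) => //= _; rewrite leNye.
have [N NP] := fin_dim_bound (finP (fine (norm x0))).
have := NP N.+1 (fun i => u i) (fun i => u_le i) (decreasing_free u_dec).
by rewrite ltnn.
Qed.

(** * The greedy construction *)

(** Reducedness tested on coefficients in k[t] only, in the form of the lower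
    bound; the opposite inequality is the ultrametric one. *)
Definition reduced_over_A (m : nat) (b : 'I_m -> L) : Prop :=
  (forall i, b i != 0%R) /\
  forall (a : 'I_m -> A) i,
    norm (a i *: b i)%R <= norm (\sum_(i < m) a i *: b i)%R.

(** What the greedy choice leaves behind: each b_i had least norm outside a
    submodule of the present span, and therefore remains a lower bound for the
    norms outside that span. *)
Definition minimal_norms (m : nat) (b : 'I_m -> L) : Prop :=
  forall i x, ~ generates b x -> norm (b i) <= norm x.

Lemma reduced_over_A_free (m : nat) (b : 'I_m -> L) (a : 'I_m -> A) :
  reduced_over_A b -> (\sum_(i < m) a i *: b i = 0)%R -> forall i, a i = 0%R.
Proof.
case: normP => _ _ nZ _ [b0 b_red] ab0 i; apply/eqP/negPn/negP => ai0.
have := b_red a i; rewrite ab0 (norm0 normP) nZ leeNy_eq.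
by have := deg_fin R ai0; have := norm_fin_num normP (b0 i);
  case: (norm _) => //; case: (deg _).
Qed.

(** The heart of the argument: dividing the other coefficients by that of y
    with remainder turns the combination into a multiple of a vector outside
    the span of b, whose norm is bounded below by minimality, plus an error
    too small to change its norm. *)
Lemma reduced_over_A_cons (m : nat) (b : 'I_m -> L) (y : L) :
  reduced_over_A b -> minimal_norms b -> ~ generates b y ->
  (forall x, ~ generates b x -> norm y <= norm x) ->
  reduced_over_A (fam_cons y b).
Proof.
case: (normP) => _ _ nZ _ [b0 b_red] b_min y_out y_min.
have y0 : y != 0%R.
  apply/eqP => yE; apply: y_out; exists (fun=> 0%R).
  by rewrite yE big1// => i _; rewrite scale0r.
split=> [i|a i].
  by case: (unliftP ord0 i) => [j ->|->]; rewrite ?fam_cons0 ?fam_consS.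
rewrite big_ord_recl fam_cons0.
under [X in norm (_ + X)%R]eq_bigr => j _ do rewrite fam_consS.
pose a' j := a (lift ord0 j).
set s := (\sum_(i < m) _)%R; set a0 := a ord0.
have a's j : norm (a' j *: b j)%R <= norm s by exact: b_red.
suff [le_y le_s] :
    norm (a0 *: y)%R <= norm (a0 *: y + s)%R /\
    norm s <= norm (a0 *: y + s)%R.
  case: (unliftP ord0 i) => [j ->|->]; rewrite ?fam_cons0 ?fam_consS//.
  exact: le_trans (a's j) le_s.
have [a00|a00] := eqVneq a0 0%R.
  by rewrite a00 scale0r add0r (norm0 normP) leNye.
(* The bound on s follows from the one on a0 *: y, since s is the difference
   of the whole sum and a0 *: y. *)
suff le_y : norm (a0 *: y)%R <= norm (a0 *: y + s)%R.
  split=> //; have := norm_le_max (a0 *: y + s)%R (a0 *: y)%R.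
  by rewrite [in X in X <= _]addrC addKr => /le_trans; apply;
    rewrite ge_max lexx.
pose q := (\sum_j (a' j %/ a0)%R *: b j)%R.
pose r := (\sum_j (a' j %% a0)%R *: b j)%R.
have -> : (a0 *: y + s = a0 *: (y + q) + r)%R.
  rewrite scalerDr -addrA; congr (_ + _)%R.
  rewrite scaler_sumr -big_split /=; apply: eq_bigr => j _.
  by rewrite scalerA -scalerDl mulrC -divp_eq.
(* y + q is outside the span of b, as y is, and y has least norm there. *)
have le_yq : norm (a0 *: y)%R <= norm (a0 *: (y + q))%R.
  rewrite !nZ leeD2l//; apply: y_min => yq_gen; apply: y_out.
  rewrite -(addrK q y); apply: generates_sub => //.
  by exists (fun j => a' j %/ a0)%R.
(* It remains to see that r is strictly smaller than a0 *: y: a remainder has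
   degree less than that of a0, and no b_j is larger than y. *)
apply: (le_trans le_yq); apply: norm_add_ge; apply: lt_le_trans le_yq.
have a0y : norm (a0 *: y)%R \is a fin_num.
  by rewrite nZ fin_numD deg_fin ?(norm_fin_num normP).
apply: (norm_sum_lt normP) => [|j].
  by move: a0y; rewrite fin_numE ltNye => /andP[].
rewrite !nZ lte_leD ?(norm_fin_num normP)//; first exact: deg_modp.
exact: b_min.
Qed.

Lemma minimal_norms_cons (m : nat) (b : 'I_m -> L) (y : L) :
  minimal_norms b -> (forall x, ~ generates b x -> norm y <= norm x) ->
  minimal_norms (fam_cons y b).
Proof.
move=> b_min y_min i x x_out.
have {}x_out : ~ generates b x.
  move=> [c cE]; apply: x_out; exists (fam_cons 0%R c).
  rewrite big_ord_recl !fam_cons0 scale0r add0r cE.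
  by apply: eq_bigr => j _; rewrite !fam_consS.
case: (unliftP ord0 i) => [j ->|->]; rewrite ?fam_cons0 ?fam_consS.
  exact: b_min.
exact: y_min.
Qed.

(** The greedy process, continued for ever if it never spanned L, would give
    reduced families of every length inside one ball. *)
Lemma exists_reduced_basis_over_A : finitely_generated L ->
  exists (m : nat) (b : 'I_m -> L), reduced_over_A b /\
    forall x, generates b x.
Proof.
move=> [n [g gP]]; apply: contrapT => nobasis.
pose r := (\big[Num.max/0]_(j < n) fine (norm (g j)))%R.
have g_le j : norm (g j) <= r%:E.
  have : (fine (norm (g j)) <= r)%R by exact: le_bigmax.
  case: normP => npinf _ _ _; have := npinf (g j).
  by case: (norm (g j)) => //= _ _; rewrite leNye.
have greedy m : exists b : 'I_m -> L,
    [/\ reduced_over_A b, minimal_norms b & forall i, norm (b i) <= r%:E].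
  elim: m => [|m [b [b_red b_min b_le]]].
    by exists (fun=> 0%R); split=> [||[]//]; [split=> [[]//|_ []//] | case].
  have [j gj_out] : exists j, ~ generates b (g j).
    apply: contrapT => g_in; apply: nobasis; exists m, b; split=> // x.
    apply: (generates_sum (g := g)) (gP x) => j.
    by apply: contrapT => gj; apply: g_in; exists j.
  have [|y y_out y_min] := @exists_min_norm (fun x => ~ generates b x).
    by exists (g j).
  exists (fam_cons y b); split.
  - exact: reduced_over_A_cons.
  - exact: minimal_norms_cons.
  - move=> i; case: (unliftP ord0 i) => [h ->|->];
      rewrite ?fam_cons0 ?fam_consS//.
    exact: le_trans (y_min _ gj_out) (g_le j).
have [N NP] := fin_dim_bound (finP r).
have [b [b_red _ b_le]] := greedy N.+1.
suff /(NP _ _ b_le) : free_over_k b by rewrite ltnn.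
move=> c cb0 i; apply/eqP; rewrite -polyC_eq0; apply/eqP.
exact: (reduced_over_A_free (a := fun i => (c i)%:P) b_red).
Qed.

End Lattice.

(** * Passage to the fraction field *)

Local Notation "x %:F" := (@FracField.tofrac _ x).

Lemma common_denominator (A : idomainType) (m : nat)
    (a : 'I_m -> {fraction A}) :
  exists2 d : A, d != 0%R &
    exists n : 'I_m -> A, forall i, (d%:F * a i = (n i)%:F)%R.
Proof.
have /choice [n /choice [d adE]] i := FracMod.fracP (a i).
exists (\prod_i d i)%R.
  by apply/prodf_neq0 => i _; have [] := adE i.
exists (fun i => (\prod_(j | j != i) d j) * n i)%R => i.
have [d0 ->] := adE i; have dF0 : (d i)%:F != 0%R by rewrite tofrac_eq0.
by rewrite (bigD1 i)//= mulrC !tofracM mulrA divfK// mulrC.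
Qed.

Lemma tofracmod_sum (A : idomainType) (L : lmodType A) m (F : 'I_m -> L) :
  tofracmod (\sum_(i < m) F i)%R = (\sum_(i < m) tofracmod (F i))%R.
Proof.
apply: (big_morph _ (@tofracmodD A L)).
by rewrite -(scale0r 0%R) tofracmodZ tofrac0 scale0r.
Qed.

Lemma tofracmod_eq0 (R : realType) (k : fieldType) (L : lmodType {poly k})
    (norm : L -> \bar R) (x : L) :
  is_norm (@deg R k) norm -> tofracmod x = 0%R -> x = 0%R.
Proof.
move=> normP x0; case: (normP) => _ _ _ n0; apply/n0.
by rewrite -(ext_norm_tofracmod normP) x0 (norm0 (ext_norm_is_norm normP)).
Qed.

(** Multiplying the coefficients by a common denominator d shifts both sides
    of the inequality by deg d and brings it back to L. *)
Lemma reduced_tofracmod (R : realType) (k : fieldType)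
    (L : lmodType {poly k}) (norm : L -> \bar R) m (b : 'I_m -> L) :
  is_norm (@deg R k) norm -> reduced_over_A norm b ->
  reduced (ext_norm norm) (fun i => tofracmod (b i)).
Proof.
move=> normP [b0 b_red]; have extP := ext_norm_is_norm normP.
case: (extP) => _ _ eZ _.
split=> [i|a]; first by apply: contra_neq (b0 i) => /(tofracmod_eq0 normP).
apply/eqP; rewrite eq_le (norm_sum_bigmax extP) /=.
apply: bigmax_le => [|i _]; first exact: leNye.
have [d d0 [n nE]] := common_denominator a.
have dfin : fdeg R d%:F \is a fin_num.
  rewrite -[d%:F]divr1 -tofrac1 fdeg_frac ?oner_neq0//.
  by rewrite fin_numB !deg_fin ?oner_neq0.
rewrite -(leeD2lE _ _ dfin) -!eZ scalerA nE scaler_sumr.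
under eq_bigr => j _ do rewrite scalerA nE -tofracmodZ.
by rewrite -tofracmodZ -tofracmod_sum !(ext_norm_tofracmod normP).
Qed.

Theorem corollary1p13 (R : realType) (k : fieldType) (L : lmodType {poly k})
    (norm : L -> \bar R) :
  is_lattice norm ->
  exists (m : nat) (b : 'I_m -> L),
    is_basis b /\ reduced (ext_norm norm) (fun i => tofracmod (b i)).
Proof.
move=> [fgL normP finP].
have [m [b [b_red b_gen]]] := exists_reduced_basis_over_A normP finP fgL.
exists m, b; split; last exact: reduced_tofracmod.
by split=> // c cb0; exact: (reduced_over_A_free normP b_red).
Qed.
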